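(* Let $\mathbb{F}=\mathbb{R}$ or $\mathbb{F}=\mathbb{C}$, let $m\geq n\geq 1$ be integers, and let $X,Y\in M_{m\times n}(\mathbb{F})$ with $\operatorname{rank} Y\geq 1$. There is a reflection $A\in M_{m}(\mathbb{F})$ such that $AX=Y$ if and only if $X^*Y$ is Hermitian and $X^*X=Y^*Y$.
   Context: $M_{m\times n}(\mathbb{F})$ is the set of $m\times n$ matrices over $\mathbb{F}$ and $M_m(\mathbb{F})=M_{m\times m}(\mathbb{F})$. $Z^*$ denotes the conjugate transpose of $Z$ (the transpose if $\mathbb{F}=\mathbb{R}$); $A$ is Hermitian if $A=A^*$. A matrix $A\in M_m(\mathbb{F})$ is a reflection if it is a Hermitian involution: $A=A^*$ and $A^2=I$ (equivalently, $A$ is Hermitian and unitary). *)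

(* Defs.v *)
From HB Require Import structures.
From mathcomp Require Import all_boot all_order all_algebra.
From mathcomp Require Import reals complex.
From mathcomp Require Import sesquilinear spectral.
Set Implicit Arguments.
Unset Strict Implicit.
Unset Printing Implicit Defensive.

Local Open Scope ring_scope.

(* [theta] is the conjugation of the scalars: the identity over the reals,
   [Num.conj] over the complex numbers. *)
Definition reflectionmx (F : fieldType) (theta : {rmorphism F -> F}) (m : nat)
    (A : 'M[F]_m) : Prop :=
  A \is hermitianmx m false theta /\ A *m A = 1%:M.

(* Main.v *)
Require Import Defs.
From HB Require Import structures.
From mathcomp Require Import all_boot all_order all_algebra.
From mathcomp Require Import reals complex.
From mathcomp Require Import sesquilinear spectral.
Set Implicit Arguments.
Unset Strict Implicit.
Unset Printing Implicit Defensive.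

Local Open Scope ring_scope.
Local Open Scope complex_scope.
Local Open Scope sesquilinear_scope.

(** If [X^* Y] is Hermitian and [X^* X = Y^* Y], then [(X - Y)^* (X + Y) = 0].
    Hence the orthogonal projection [P] onto the column space of [X - Y] fixes
    [X - Y] and kills [X + Y], so [2 P X = X - Y] and the reflection [1 - 2 P]
    maps [X] to [Y]. *)

Import GRing.Theory Num.Theory.

Section ConjugateTranspose.
Variables (F : fieldType) (theta : {rmorphism F -> F}).

Lemma ctmx_mul m n p (A : 'M[F]_(m, n)) (B : 'M[F]_(n, p)) :
  (A *m B) ^t theta = B ^t theta *m A ^t theta.
Proof. by rewrite trmx_mul map_mxM. Qed.

Lemma ctmxK m n (A : 'M[F]_(m, n)) :
  involutive theta -> A ^t theta ^t theta = A.
Proof. by move=> thetaK; apply/matrixP=> i j; rewrite !mxE thetaK. Qed.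

Lemma hermitianmxFP n (A : 'M[F]_n) :
  reflect (A ^t theta = A) (A \is hermitianmx n false theta).
Proof.
by rewrite is_hermitianmxE expr0 scale1r eq_sym; apply: (iffP eqP).
Qed.

End ConjugateTranspose.

Section PositiveConjugation.
Variables (F : numFieldType) (theta : {rmorphism F -> F}).
(** Both properties hold for the identity of the reals and for complex conjugation, so one argument
    serves the two fields. *)
Hypothesis thetaK : involutive theta.
Hypothesis theta_ge0 : forall x, 0 <= x * theta x.

(** The only entry of the product is a sum of nonnegative terms [x * theta x]; each one vanishes,
    and [theta] is injective. *)
Lemma ctmx_anisotropic n (v : 'rV[F]_n) : v *m v ^t theta = 0 -> v = 0.
Proof.
move=> /matrixP/(_ 0 0); rewrite !mxE.
under eq_bigr do rewrite !mxE.
move=> /psumr_eq0P sum0; apply/rowP=> j; rewrite mxE; apply/eqP.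
move/eqP: (sum0 (fun i _ => theta_ge0 _) j isT).
by rewrite mulf_eq0 fmorph_eq0 orbb.
Qed.

(** If [v] kills the Gram matrix, then [v *m B] is orthogonal to itself, hence zero. *)
Lemma gram_unitmx r m (B : 'M[F]_(r, m)) :
  row_free B -> B *m B ^t theta \in unitmx.
Proof.
move=> freeB; rewrite -row_free_unit; apply: inj_row_free => v vG0.
apply/eqP; rewrite -(mulmx_free_eq0 _ freeB); apply/eqP/ctmx_anisotropic.
by rewrite ctmx_mul mulmxA -(mulmxA v) vG0 mul0mx.
Qed.

Lemma orthogonal_projection m n (W : 'M[F]_(m, n)) :
  exists P : 'M[F]_m, [/\ P ^t theta = P, P *m P = P, P *m W = W &
    forall p (V : 'M[F]_(m, p)), W ^t theta *m V = 0 -> P *m V = 0].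
Proof.
(* The Gram matrix of [W] itself may be singular, so [W ^t theta] is replaced by a basis [B] of its
   row space. *)
have [r [B freeB eqB]] : exists r, exists2 B : 'M[F]_(r, m),
    row_free B & (B :=: W ^t theta)%MS.
  by eexists; exists (row_base (W ^t theta));
     [exact: row_base_free | exact: eq_row_base].
pose G := B *m B ^t theta; have Gu : G \in unitmx by exact: gram_unitmx.
pose P := B ^t theta *m invmx G *m B.
have BP : B *m P = B by rewrite /P !mulmxA mulmxV ?mul1mx.
have Pherm : P ^t theta = P.
  rewrite /P !ctmx_mul ctmxK // trmx_inv map_invmx.
  by rewrite /G ctmx_mul ctmxK // !mulmxA.
exists P; split=> [//|||p V WV0].
- by rewrite {1}/P -mulmxA BP.
- have /submxP[D WD] : (W ^t theta <= B)%MS by rewrite eqB.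
  (* Conjugate transposition turns the goal into [W ^t theta *m P = W ^t theta], where
     [W ^t theta = D *m B]. *)
  by rewrite -(ctmxK W thetaK) -{1}Pherm -ctmx_mul WD -mulmxA BP.
- have /submxP[D BD] : (B <= W ^t theta)%MS by rewrite eqB.
  by rewrite /P -mulmxA BD -(mulmxA D) WV0 !mulmx0.
Qed.

Lemma reflectionmx_mapP m n (X Y : 'M[F]_(m, n)) :
  (exists A : 'M[F]_m, reflectionmx theta A /\ A *m X = Y) <->
  (X ^t theta *m Y \is hermitianmx n false theta /\
   X ^t theta *m X = Y ^t theta *m Y).
Proof.
split=> [[A [[/hermitianmxFP Aherm AA] <-]]|[/hermitianmxFP XYherm XX]].
  split; first by apply/hermitianmxFP; rewrite !ctmx_mul ctmxK // Aherm mulmxA.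
  by rewrite ctmx_mul Aherm mulmxA -(mulmxA _ A A) AA mulmx1.
have [P [Pherm PP PW PV]] := orthogonal_projection (X - Y).
have {}PV : P *m (X + Y) = 0.
  (* On expansion, the squares cancel by [XX] and the cross terms by [XYherm]. *)
  apply: PV; rewrite raddfB map_mxB mulmxBl !mulmxDr -XX.
  by rewrite -XYherm ctmx_mul ctmxK // [X in X - _]addrC subrr.
exists (1%:M - P *+ 2); split; first split.
- apply/hermitianmxFP.
  by rewrite !raddfB !raddfMn /= trmx1 map_mx1 Pherm.
- rewrite mulmxBl mul1mx mulmxBr mulmx1 mulr2n mulmxDl !mulmxDr PP.
  by rewrite opprB addrK subrK.
- rewrite mulmxBl mul1mx mulr2n mulmxDl.
  (* Only one of the two copies of [P *m X] becomes [- (P *m Y)], so that their sum is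
     [P *m (X - Y)]. *)
  move: PW PV; rewrite mulmxBr mulmxDr => PW /eqP; rewrite addr_eq0 => /eqP PX.
  by rewrite {2}PX PW opprB addrC subrK.
Qed.

End PositiveConjugation.

Theorem theorem7p1 (R : realType) (m n : nat) (hn : (1 <= n)%N)
    (hmn : (n <= m)%N) :
  (forall X Y : 'M[R]_(m, n), (1 <= \rank Y)%N ->
     (exists A : 'M[R]_m, reflectionmx idfun A /\ A *m X = Y) <->
     (X^T *m Y \is symmetricmx /\ X^T *m X = Y^T *m Y)) /\
  (forall X Y : 'M[R[i]]_(m, n), (1 <= \rank Y)%N ->
     (exists A : 'M[R[i]]_m, reflectionmx Num.conj A /\ A *m X = Y) <->
     (X ^t* *m Y \is hermsymmx /\ X ^t* *m X = Y ^t* *m Y)).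
Proof.
split=> X Y _.
  (* Over the reals, plain transposes are recast as conjugate transposes for [idfun]; positivity is
     that of squares. *)
  rewrite -[X^T](@map_mx_id _ _ _ idfun) //
    -[Y^T](@map_mx_id _ _ _ idfun) //.
  by apply: reflectionmx_mapP => // x; rewrite -expr2 sqr_ge0.
by apply: reflectionmx_mapP => [x|x]; [exact: conjCK | exact: mul_conjC_ge0].
Qed.
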